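(* Let $\delta\in\{\mathsf{none},\mathsf{down},\mathsf{up},\mathsf{updown}\}^n$. The polytope $\mathcal{C}_\delta$ (the convex hull of the cubic vectors of all $\delta$-permutrees) is normally equivalent to the $(n-1)$-dimensional cube, i.e. it has the same normal fan as the cube.
   Context: A permutree on $n$ vertices is a directed (unrooted, planar) tree $T$ with vertex set $\{v_1,\dots,v_n\}$, edges oriented from child to parent, such that each vertex $v_i$ has exactly one or two parents and exactly one or two children, and: if $v_i$ has two parents then every vertex $v_j$ in its left ancestor subtree has $j<i$ and every $v_k$ in its right ancestor subtree has $k>i$; if $v_i$ has two children then every $v_j$ in its left descendant subtree $LD_i$ has $j<i$ and every $v_k$ in its right descendant subtree $RD_i$ has $k>i$ (ancestor/descendant subtrees are the components of $T\setminus v_i$ containing the respective parents/children; if $v_i$ has one child, $D_i$ denotes its unique descendant subtree). The decoration $\delta(T)_i$ is $\mathsf{none}$, $\mathsf{down}$, $\mathsf{up}$, $\mathsf{updown}$ according as $v_i$ has (one parent, one child), (one parent, two children), (two parents, one child), (two parents, two children); $\mathcal{PT}_n(\delta)$ is the set of permutrees with decoration $\delta$ (convention $\delta_1=\delta_n=\mathsf{none}$). The cubic set of $T$ is $C(T)=\{(i,j): i<j,\ v_j\in D_i\text{ if }\delta_i\in\{\mathsf{none},\mathsf{up}\};\ v_j\in RD_i\text{ if }\delta_i\in\{\mathsf{down},\mathsf{updown}\}\}$, with components $C(T)_i=\{j:(i,j)\in C(T)\}$, and the cubic vector is $\vec{c}(T)=(c_1,\dots,c_{n-1})\in\mathbb{R}^{n-1}$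 with $c_i=|C(T)_i|$. $\mathcal{C}_\delta$ denotes the convex hull of $\{\vec{c}(T):T\in\mathcal{PT}_n(\delta)\}$. *)

(* Defs.v *)
From HB Require Import structures.
From mathcomp Require Import all_boot all_order all_algebra.
From mathcomp Require Import boolp classical_sets reals convex.

Set Implicit Arguments.
Unset Strict Implicit.
Unset Printing Implicit Defensive.

Import Order.TTheory GRing.Theory Num.Theory.

Local Open Scope classical_set_scope.
Local Open Scope ring_scope.

Section PlanarTrees.
Variable n : nat.

(* A finite tree in which every vertex has a parent and a child must have
   dangling edges (unlabelled leaves); they bound empty subtrees.  A planar
   directed tree is thus given by the left-to-right lists of parents and of
   children of each vertex, where the entry [None] is a dangling edge. *)
Variables parents children : 'I_n -> seq (option 'I_n).

Definition edge : rel 'I_n := [rel i j | Some j \in parents i].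

Definition adj : rel 'I_n := [rel i j | edge i j || edge j i].

Definition adj_avoiding (i : 'I_n) : rel 'I_n :=
  [rel x y | [&& adj x y, x != i & y != i]].

(* The component of the tree minus v_i reached through the slot [s] of v_i. *)
Definition subtree_at (i : 'I_n) (s : option 'I_n) : {set 'I_n} :=
  if s is Some a then [set j | connect (adj_avoiding i) a j]%SET else finset.set0.

Definition is_directed_tree : Prop :=
  [/\ forall i j, (Some i \in children j) = edge i j,
      forall i j, edge i j -> ~~ edge j i,
      forall i j, connect adj i j
    & forall c : seq 'I_n, (2 < size c)%N -> ~ ucycle adj c].

(* Condition on the parents (resp. children) of v_i, listed in [s]. *)
Definition slots_ok (i : 'I_n) (s : seq (option 'I_n)) : Prop :=
  (size s = 1 \/ size s = 2)%N /\
  (size s = 2%N ->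
     (forall j, j \in subtree_at i (nth None s 0) -> (j < i)%N) /\
     (forall k, k \in subtree_at i (nth None s 1) -> (i < k)%N)).

End PlanarTrees.

Record permutree (n : nat) := Permutree {
  parents : 'I_n -> seq (option 'I_n);
  children : 'I_n -> seq (option 'I_n);
  permutree_tree : is_directed_tree parents children;
  permutree_parents : forall i, slots_ok parents i (parents i);
  permutree_children : forall i, slots_ok parents i (children i)
}.

Variant decoration := none | down | up | updown.

Section CubicVectors.
Variables (n : nat) (T : permutree n).

Definition deco (i : 'I_n) : decoration :=
  match size (parents T i) == 2%N, size (children T i) == 2%N with
  | false, false => none
  | false, true => down
  | true, false => up
  | true, true => updown
  end.

(* [desc i] is meant for a vertex with one child, [rdesc i] for a vertex with
   two children. *)
Definition desc (i : 'I_n) : {set 'I_n} :=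
  subtree_at (parents T) i (nth None (children T i) 0).
Definition rdesc (i : 'I_n) : {set 'I_n} :=
  subtree_at (parents T) i (nth None (children T i) 1).

Definition cubic_set : {set 'I_n * 'I_n} :=
  [set p : 'I_n * 'I_n | (p.1 < p.2)%N &&
     match deco p.1 with
     | none | up => p.2 \in desc p.1
     | down | updown => p.2 \in rdesc p.1
     end]%SET.

Definition cubic_comp (i : 'I_n) : {set 'I_n} :=
  [set j | (i, j) \in cubic_set]%SET.

Definition cubic_vector (R : realType) : 'rV[R]_n.-1 :=
  \row_(i < n.-1) #|cubic_comp (widen_ord (leq_pred n) i)|%:R.

End CubicVectors.

Definition permutrees (n : nat) (delta : 'I_n -> decoration) :
    set (permutree n) :=
  [set T | deco T =1 delta].

Section NormalFans.
Variables (R : realType) (d : nat).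
Implicit Types (A P F : set 'rV[R]_d) (w x y : 'rV[R]_d).

Definition conv_hull A : set 'rV[R]_d :=
  smallest (@convex_set R 'rV[R]_d) A.

Definition dotv w x : R := \sum_(i < d) w 0 i * x 0 i.

Definition face_in_dir P w : set 'rV[R]_d :=
  [set x | P x /\ forall y, P y -> dotv w y <= dotv w x].

Definition is_face P F : Prop :=
  F !=set0 /\ exists w, F = face_in_dir P w.

Definition normal_cone P F : set 'rV[R]_d :=
  [set w | F `<=` face_in_dir P w].

Definition normal_fan P : set (set 'rV[R]_d) :=
  [set normal_cone P F | F in is_face P].

Definition normally_equivalent P Q : Prop := normal_fan P = normal_fan Q.

Definition cube : set 'rV[R]_d := [set x | forall i, 0 <= x 0 i <= 1].

End NormalFans.

Definition cubic_polytope (R : realType) (n : nat)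
    (delta : 'I_n -> decoration) : set 'rV[R]_n.-1 :=
  conv_hull [set cubic_vector T R | T in permutrees delta].

Arguments cubic_polytope R [n] delta.
Arguments cube R d : clear implicits.

(* Main.v *)
Require Import Defs.
From mathcomp Require Import all_boot all_order all_algebra.
From mathcomp Require Import unstable boolp classical_sets reals.
From mathcomp Require Import interval_inference convex lra.

(* The polytope is a box.  Each [c_i] lies between [0] and the number of
   [j > i], so it suffices to realise every vertex of the box
   [prod_i [0, n - i]]: given a set [S] of indices, we need a permutree in
   which every [i] in [S] lies above all [j > i], and every other [i < n] lies
   below them.  Insert the vertices in increasing order.  The vertices still
   to come hang from the last placed element of [S] and rest on the last
   placed element outside [S], unless a new vertex closes one of these two
   attachments: a vertex always takes over the attachment on the side where it
   is placed, and it also takes (and closes off) the other one when its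
   decoration gives it a second slot there.  Every vertex except the last thus
   has exactly one larger neighbour, the first later vertex taking its
   attachment, which makes connectedness and acyclicity immediate.

   All boxes with nonempty interior share the normal fan of the cube, because
   the normal cone of the face maximising [w] depends only on the signs of the
   coordinates of [w]. *)

Set Implicit Arguments.
Unset Strict Implicit.
Unset Printing Implicit Defensive.

Import Order.TTheory GRing.Theory Num.Theory.

Section ConnectInvariant.
Variables (T : finType) (e : rel T) (P : T -> Prop).

Lemma connect_invariant x y :
  (forall u v, e u v -> P u -> P v) -> connect e x y -> P x -> P y.
Proof.
move=> eP /connectP[s pxs ->] {y}; elim: s x pxs => //= z s IHs x.
by case/andP=> exz /IHs Pzs Px; apply/Pzs/(eP x).
Qed.

End ConnectInvariant.

(** * Trees in which each vertex but the last has one larger neighbour *)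

Section IncreasingTree.
Variables (m : nat) (par : 'I_m.+1 -> seq (option 'I_m.+1)).
Variable p : 'I_m.+1 -> 'I_m.+1.
Hypothesis ltp : forall x, x != ord_max -> x < p x.
Hypothesis adjE : forall x y,
  adj par x y = (x < y) && (p x == y) || (y < x) && (p y == x).

Lemma increasing_tree_connected x y : connect (adj par) x y.
Proof.
have symC : connect_sym (adj par).
  by apply: sym_connect_sym => u v; rewrite !adjE orbC.
suff toroot z : connect (adj par) z ord_max.
  by apply: connect_trans (toroot x) _; rewrite symC.
have [k] := ubnP (m - z); elim: k z => // k IHk z lek.
have [->|zmax] := eqVneq z ord_max; first exact: connect0.
have ltz := ltp zmax.
apply: (connect_trans (y := p z)); first by rewrite connect1 // adjE ltz eqxx.
apply: IHk; rewrite -ltnS; apply: leq_trans lek.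
by rewrite ltnS ltn_sub2l // (leq_trans ltz) // -ltnS.
Qed.

(* Both neighbours of the least vertex of a cycle would be its image by p. *)
Lemma increasing_tree_acyclic (c : seq 'I_m.+1) :
  2 < size c -> ~ ucycle (adj par) c.
Proof.
case: c => [//|x0 c0]; set c := x0 :: c0 => szc cc.
have x0c : x0 \in c by rewrite mem_head.
have [x xc minx] := @arg_minnP _ x0 [in c] (@nat_of_ord _) x0c.
have [i s Dc] := rot_to xc.
have upx y : adj par x y -> y \in c -> y = p x.
  move=> + /minx lexy; rewrite adjE [y < x]ltnNge lexy orbF.
  by case/andP=> _ /eqP.
move: cc szc; rewrite -(rot_ucycle i) -(size_rot i) Dc.
have inc y : y \in x :: s -> y \in c by rewrite -Dc mem_rot.
case: s inc {Dc} => [//|y [//|z s]] inc /andP[/=].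
rewrite rcons_path => /and4P[exy _ _ elx] /and3P[_ nys _] _.
rewrite adjE orbC -adjE in elx.
case/negP: nys.
have yc : y \in c by rewrite inc // !inE eqxx orbT.
have lc : last z s \in c by rewrite inc // 2!in_cons mem_last !orbT.
by rewrite (upx y exy yc) -(upx _ elx lc) mem_last.
Qed.

(** Every vertex reached from [a] while avoiding [i] climbs to [a] along [p]: a step down preserves
    this, and a step up either follows the climb or leaves [a] and hits [i]. Climbing increases, so
    such a vertex is at most [a]. *)
Lemma subtree_at_lower (i a j : 'I_m.+1) :
  p a = i -> a < i -> j \in subtree_at par i (Some a) -> j < i.
Proof.
move=> pai ltai; rewrite inE => caj.
set e := [rel x y : 'I_m.+1 | (x < y) && (p x == y)].
suff: connect e j a.
  move=> cja; suff: j <= a by move/leq_ltn_trans; apply.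
  apply: (connect_invariant (P := fun x : 'I_m.+1 => j <= x)) cja _ => //.
  by move=> u v /= /andP[/ltnW leuv _] /leq_trans; apply.
apply: (connect_invariant (P := fun x => connect e x a)) caj _ => //.
move=> u v /and3P[]; rewrite adjE => /orP[/andP[ltuv /eqP puv]|euv] _ vi cua.
  case/connectP: cua => [[|w s]] /= => [_ au|/andP[/andP[_ /eqP puw] pws] ->].
    by case/eqP: vi; rewrite -puv -au pai.
  by apply/connectP; exists s; rewrite // -puv puw.
by apply: connect_trans cua; apply: connect1.
Qed.

(** Iterating [p] from any vertex above [i] only increases, hence reaches the last vertex without
    meeting [i]. *)
Lemma mem_subtree_at_upper (i j : 'I_m.+1) :
  i < j -> j \in subtree_at par i (Some (p i)).
Proof.
rewrite inE => ltij.
have symC : connect_sym (adj_avoiding par i).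
  apply: sym_connect_sym => u v.
  by rewrite /adj_avoiding /= !adjE orbC [(u != i) && _]andbC.
suff toroot (z : 'I_m.+1) : i < z -> connect (adj_avoiding par i) z ord_max.
  have imax : i != ord_max.
    by apply: contraTneq ltij => ->; rewrite -leqNgt -ltnS.
  apply: connect_trans (toroot _ (ltp imax)) _.
  by rewrite symC toroot.
have [k] := ubnP (m - z); elim: k z => // k IHk z lek ltiz.
have [->|zmax] := eqVneq z ord_max; first exact: connect0.
have ltz := ltp zmax; have ltipz := ltn_trans ltiz ltz.
apply: (connect_trans (y := p z)).
  rewrite connect1 // /adj_avoiding /= adjE ltz eqxx /=.
  by rewrite -!(inj_eq val_inj) /= !gtn_eqF.
apply: IHk => //; rewrite -ltnS; apply: leq_trans lek.
by rewrite ltnS ltn_sub2l // (leq_trans ltz) // -ltnS.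
Qed.

(** The second hypothesis says that no edge jumps over [i], so a walk avoiding [i] cannot cross
    it. *)
Lemma subtree_at_upper (i j : 'I_m.+1) :
    i < p i -> (forall y : 'I_m.+1, y < i -> p y <= i) ->
  j \in subtree_at par i (Some (p i)) -> i < j.
Proof.
move=> ltipi pin; rewrite inE => cij.
apply: (connect_invariant (P := fun x : 'I_m.+1 => i < x)) cij _ => //.
move=> u v /and3P[]; rewrite adjE => /orP[/andP[ltuv _]|/andP[_ /eqP pvu]] _.
  by move=> _ ltiu; apply: ltn_trans ltuv.
move=> vi ltiu; have [//|ltvi|/val_inj iv] := ltngtP i v.
  by move: ltiu; rewrite ltnNge -pvu pin.
by rewrite iv eqxx in vi.
Qed.

End IncreasingTree.

(** * The permutree realising a given vertex of the box *)

Section CubeVertex.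
Variables (m : nat) (delta : 'I_m.+1 -> decoration) (S : pred 'I_m.+1).

(* With [b = true], whether [j] has two parents; with [b = false], whether it
   has two children. *)
Definition two_slots (b : bool) (j : 'I_m.+1) : bool :=
  match delta j with
  | none => false | Defs.down => ~~ b | up => b | updown => true
  end.

(** The attachment on side [b] ends at a vertex placed on that side, which takes it over, or at one
    with a second slot there, which closes it off; the last vertex ends both. *)
Definition stops (b : bool) (j : 'I_m.+1) : bool :=
  [|| S j == b, j == ord_max | two_slots b j].

Definition upper (i : 'I_m.+1) : 'I_m.+1 :=
  [arg min_(j < ord_max | (i < j) && stops (S i) j) j].

Lemma upperP i : i != ord_max ->
  [/\ i < upper i, stops (S i) (upper i)
    & forall j : 'I_m.+1, i < j -> stops (S i) j -> upper i <= j].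
Proof.
move=> imax; rewrite /upper; case: arg_minnP => [|j /andP[ltij sj] minj].
  rewrite /stops eqxx orbT andbT ltn_neqAle -ltnS ltn_ord andbT.
  by rewrite (inj_eq val_inj).
by split=> // k ltik sk; apply: minj; rewrite ltik.
Qed.

Lemma lt_upper i : i != ord_max -> i < upper i.
Proof. by case/upperP. Qed.

Lemma ltn_neq_max (i j : 'I_m.+1) : i < j -> i != ord_max.
Proof. by apply: contraTneq => ->; rewrite -leqNgt -ltnS. Qed.

Definition lower (b : bool) (j : 'I_m.+1) : option 'I_m.+1 :=
  [pick i : 'I_m.+1 | [&& S i == b, i < j & upper i == j]].

(** The choice in [lower] is unique: of two candidates on the same side, the larger would already
    stop the smaller before [j]. *)
Lemma lowerE b (i j : 'I_m.+1) :
  (Some i == lower b j) = [&& S i == b, i < j & upper i == j].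
Proof.
rewrite /lower; case: pickP => [k /and3P[Sk ltkj /eqP pk]|/(_ i) -> //].
apply/eqP/idP => [[->]|/and3P[Si ltij /eqP pi]]; first by rewrite Sk ltkj pk eqxx.
congr Some; apply: val_inj => /=.
have [_ _ mini] := upperP (ltn_neq_max ltij).
have [_ _ mink] := upperP (ltn_neq_max ltkj).
case: (ltngtP i k) => // [ltik|ltki].
  by have := mini k ltik; rewrite /stops (eqP Sk) (eqP Si) eqxx pi leqNgt ltkj => /(_ isT).
by have := mink i ltki; rewrite /stops (eqP Si) (eqP Sk) eqxx pk leqNgt ltij => /(_ isT).
Qed.

Definition rises (b : bool) (j : 'I_m.+1) : bool :=
  (S j != b) && (j != ord_max).

Definition slots (b : bool) (j : 'I_m.+1) : seq (option 'I_m.+1) :=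
  if two_slots b j then
    [:: lower b j; if rises b j then Some (upper j) else None]
  else [:: if rises b j then Some (upper j) else lower b j].

Lemma size_slots b j : size (slots b j) = (two_slots b j).+1.
Proof. by rewrite /slots; case: two_slots. Qed.

Lemma mem_slots b (i j : 'I_m.+1) :
  (Some i \in slots b j) =
  [&& S i == b, i < j & upper i == j] || [&& S j != b, j < i & upper j == i].
Proof.
have risesE : (rises b j && (i == upper j)) =
    [&& S j != b, j < i & upper j == i].
  rewrite /rises -andbA [i == _]eq_sym; congr andb; apply/andP/andP => [][H /eqP <-].
    by rewrite eqxx lt_upper.
  by rewrite eqxx (ltn_neq_max H).
rewrite -lowerE -risesE /slots.
case twoj: two_slots; rewrite !inE.
  by congr orb; case: rises.
(* A lone slot given to the upper neighbour displaces no lower one: [j] does not stop side [b], so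
   [lower b j] is empty. *)
case rj: rises; rewrite /= ?orbF // (_ : (Some i == lower b j) = false) //.
rewrite lowerE; apply/and3P=> -[/eqP Si ltij /eqP pij].
have [_ + _] := upperP (ltn_neq_max ltij).
by case/andP: rj => /negPf Sj /negPf jm; rewrite /stops pij Si Sj jm twoj.
Qed.

Lemma edge_slots (i j : 'I_m.+1) : edge (slots true) i j =
  [&& ~~ S i, i < j & upper i == j] || [&& S j, j < i & upper j == i].
Proof. by rewrite /edge /= mem_slots orbC !eqb_id. Qed.

Lemma adj_slots (i j : 'I_m.+1) : adj (slots true) i j =
  (i < j) && (upper i == j) || (j < i) && (upper j == i).
Proof.
rewrite /adj /= !edge_slots.
by case: (S i); case: (S j); rewrite /= ?orbF ?orFb // orbC.
Qed.

Lemma slots_tree : is_directed_tree (slots true) (slots false).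
Proof.
split.
- by move=> i j; rewrite edge_slots mem_slots eqbF_neg; case: (S j).
- move=> i j; rewrite !edge_slots.
  by case: ltngtP; case: (S i); case: (S j); rewrite ?andbF.
- exact/increasing_tree_connected/adj_slots/lt_upper.
- exact/increasing_tree_acyclic/adj_slots.
Qed.

Lemma lower_subtree b (i j : 'I_m.+1) :
  j \in subtree_at (slots true) i (lower b i) -> j < i.
Proof.
case Dl: (lower b i) => [a|]; last by rewrite inE.
have := lowerE b a i; rewrite Dl eqxx => /esym/and3P[_ ltai /eqP pai].
exact: (subtree_at_lower adj_slots pai ltai).
Qed.

(* A vertex with two slots on the side of its upper neighbour is never skipped
   by [upper]. *)
Lemma upper_subtree b (i j : 'I_m.+1) : rises b i -> two_slots b i ->
  j \in subtree_at (slots true) i (Some (upper i)) -> i < j.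
Proof.
case/andP=> Si imax twoi; apply: (subtree_at_upper adj_slots (lt_upper imax)).
move=> y ltyi; have [_ _ ->] := upperP (ltn_neq_max ltyi); rewrite //.
rewrite /stops; case: eqVneq => //= nS.
by case: (S i) b (S y) Si twoi nS => [] [] [] //= _ ->; rewrite orbT.
Qed.

Lemma slots_slots_ok b i : slots_ok (slots true) i (slots b i).
Proof.
split; first by rewrite size_slots; case: two_slots; [right|left].
rewrite size_slots /slots; case twoi: two_slots => // _; split=> j.
  exact: lower_subtree.
rewrite /nth; case ri: rises; last by rewrite inE.
exact: upper_subtree twoi.
Qed.

Definition vertex_permutree : permutree m.+1 :=
  Permutree slots_tree (slots_slots_ok true) (slots_slots_ok false).

Lemma deco_vertex_permutree : deco vertex_permutree =1 delta.
Proof.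
by move=> i; rewrite /deco !size_slots /two_slots; case: (delta i).
Qed.

Lemma cubic_comp_vertex_permutree i : i != ord_max ->
  cubic_comp vertex_permutree i =
  if S i then [set j : 'I_m.+1 | i < j]%SET else finset.set0.
Proof.
move=> imax; apply/setP=> j; rewrite !inE /= deco_vertex_permutree.
(* The slot inspected is the last child slot: it holds the upper neighbour when [S i]; otherwise a
   second slot is empty and a lone one leads only to smaller vertices. *)
have -> : (match delta i with
           | none | up => j \in desc vertex_permutree i
           | Defs.down | updown => j \in rdesc vertex_permutree i end) =
  (j \in subtree_at (slots true) i
     (if S i then Some (upper i)
      else if two_slots false i then None else lower false i)).
  rewrite /desc /rdesc /= /slots /rises /two_slots imax andbT eqbF_neg negbK.
  by case: (delta i); case: (S i).
case: (S i); rewrite [RHS]inE.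
  by apply: andb_idr => /(mem_subtree_at_upper lt_upper adj_slots).
apply: contraTF isT => /andP[ltij]; case: two_slots; first by rewrite inE.
by move/lower_subtree; rewrite ltnNge ltnW.
Qed.

End CubeVertex.

(** * Boxes as convex hulls, and their normal fans *)

Section Box.
Local Open Scope classical_set_scope.
Local Open Scope ring_scope.
Variables (R : realType) (d : nat).
Implicit Types (M w x y : 'rV[R]_d).

Definition box M : set 'rV[R]_d := [set x | forall i, 0 <= x 0 i <= M 0 i].

Definition box_vertex M (S : pred 'I_d) : 'rV[R]_d :=
  \row_i (if S i then M 0 i else 0).

(** The closed cone of the coordinate hyperplane arrangement that has [w] in its relative
    interior. *)
Definition sign_cone w : set 'rV[R]_d :=
  [set v | forall i, [/\ 0 < w 0 i -> 0 <= v 0 i, w 0 i < 0 -> v 0 i <= 0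
                       & w 0 i = 0 -> v 0 i = 0]].

Lemma cube_box : cube R d = box (const_mx 1).
Proof. by apply/seteqP; split=> x /= bx i; have := bx i; rewrite mxE. Qed.

Lemma convex_box M : convex_set (box M).
Proof.
move=> x y t /set_mem bx /set_mem By; apply/mem_set => i.
have /andP[x0 xM] := bx i; have /andP[y0 yM] := By i.
have t0 : 0 <= t%:inum by []; have t1 : t%:inum <= 1 by [].
by rewrite !mxE /onem; nra.
Qed.

Section Positive.
Variable M : 'rV[R]_d.
Hypothesis M_gt0 : forall i, 0 < M 0 i.

(** Coordinates are freed one at a time: a point is a convex combination, with weight [t], of the
    two points that push coordinate [o] to its ends. *)
Lemma box_sub_convex (C : set 'rV[R]_d) : @convex_set R 'rV[R]_d C ->
  (forall S, C (box_vertex M S)) -> box M `<=` C.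
Proof.
move=> cC vC x bx.
suff main k : (k <= d)%N -> forall y, box M y ->
    (forall i : 'I_d, (k <= i)%N -> y 0 i = 0 \/ y 0 i = M 0 i) -> C y.
  by apply: (main d (leqnn d) x bx) => i; rewrite leqNgt ltn_ord.
elim: k => [_ y _ vy|k IHk ltkd y By vy].
  rewrite (_ : y = box_vertex M (fun i => y 0 i == M 0 i)); first exact: vC.
  apply/rowP=> i; rewrite mxE; case: eqP => // yM.
  by case: (vy i).
pose o := Ordinal ltkd; pose t := y 0 o / M 0 o.
have /andP[y0 yM] := By o.
have t0 : 0 <= t by rewrite divr_ge0 // ltW.
have t1 : t <= 1 by rewrite ler_pdivrMr // mul1r.
pose z (a : R) : 'rV[R]_d := \row_i (if i == o then a else y 0 i).
have Cz a : a = 0 \/ a = M 0 o -> C (z a).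
  move=> aE; apply: IHk; first exact: ltnW.
    move=> i; rewrite mxE; case: eqP => [->|_]; last exact: By.
    by case: aE => ->; rewrite lexx ltW.
  move=> i leki; rewrite mxE; case: eqP => [->//|io].
  apply: vy; rewrite ltn_neqAle leki andbT; apply/eqP=> ki.
  by apply: io; apply: val_inj.
have := @cC (z (M 0 o)) (z 0) (@Itv01 R t t0 t1).
rewrite !inE => /(_ (Cz _ (or_intror erefl)) (Cz _ (or_introl erefl))).
set u := (X in C X); suff -> : u = y by [].
apply/rowP=> i; rewrite /u !mxE /= /onem; case: eqP => [->|_].
  by rewrite mulr0 addr0 divfK // gt_eqF.
by rewrite -mulrDl addrC subrK mul1r.
Qed.

Lemma conv_hull_box (A : set 'rV[R]_d) :
  A `<=` box M -> (forall S, A (box_vertex M S)) -> conv_hull A = box M.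
Proof.
move=> AM vA; apply/seteqP; split; first exact: (smallest_sub (@convex_box M) AM).
by move=> x bx C [cC subAC]; apply: (box_sub_convex cC) bx => S; apply/subAC/vA.
Qed.

Lemma face_in_dir_boxP w x : face_in_dir (box M) w x <->
  box M x /\ forall i, (0 < w 0 i -> x 0 i = M 0 i) /\ (w 0 i < 0 -> x 0 i = 0).
Proof.
split=> [[bx maxx]|[bx xw]]; split=> //.
  (* Changing one coordinate of a maximiser within its bounds stays in the box, so each term of the
     scalar product is maximal by itself. *)
  move=> i; pose z (a : R) : 'rV[R]_d := \row_j (if j == i then a else x 0 j).
  have zle a : 0 <= a <= M 0 i -> w 0 i * a <= w 0 i * x 0 i.
    move=> aM; have /maxx : box M (z a).
      by move=> j; rewrite mxE; case: eqP => [->|].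
    rewrite /dotv (bigD1 i) //= [leRHS](bigD1 i) //= mxE eqxx.
    rewrite (eq_bigr (fun j => w 0 j * x 0 j)) ?lerD2r // => j /negPf ji.
    by rewrite mxE ji.
  have /andP[x0 xM] := bx i; have Mi := M_gt0 i; split=> wi.
    apply/eqP; rewrite eq_le xM -(ler_pM2l wi) zle // lexx andbT; exact: ltW.
  apply/eqP; rewrite eq_le x0 andbT -(ler_nM2l wi) zle // lexx; exact: ltW.
move=> y By; apply: ler_sum => i _.
have [wp wn] := xw i; have /andP[y0 yM] := By i.
have [wi|wi|->] := ltrgt0P (w 0 i); last by rewrite !mul0r.
  by rewrite (wp wi) ler_pM2l.
by rewrite (wn wi) ler_nM2l.
Qed.

Lemma normal_cone_box w :
  normal_cone (box M) (face_in_dir (box M) w) = sign_cone w.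
Proof.
apply/seteqP; split=> v /= sub.
  (* Coordinates where [w] vanishes are free on the face; placing them at both ends, [e = 0] and
     [e = 1], forces [v] to vanish there. *)
  have face (e : R) : 0 <= e <= 1 -> face_in_dir (box M) w
      (\row_i (if 0 < w 0 i then M 0 i else if w 0 i < 0 then 0 else e * M 0 i)).
    case/andP=> e0 e1; apply/face_in_dir_boxP; split=> i; rewrite mxE.
      by have Mi := M_gt0 i; case: ltrgt0P => _; nra.
    by case: ltrgt0P.
  have /face/sub/face_in_dir_boxP[_ v0] : 0 <= (0 : R) <= 1 by lra.
  have /face/sub/face_in_dir_boxP[_ v1] : 0 <= (1 : R) <= 1 by lra.
  move=> i; have Mi := M_gt0 i; move: (v0 i) (v1 i); rewrite !mxE.
  case: (ltrgt0P (w 0 i)) => wi [a b] [a' b']; split=> w0; lra.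
move=> x /face_in_dir_boxP[bx xw]; apply/face_in_dir_boxP; split=> // i.
have [wp wn] := xw i; have [vp vn v0] := sub i.
have [wi|wi|/v0 ->] := ltrgt0P (w 0 i); last by rewrite !ltxx.
  by split=> [_|vi]; [exact: wp | have := vp wi; lra].
by split=> [vi|_]; [have := vn wi; lra | exact: wn].
Qed.

Lemma normal_fan_box : normal_fan (box M) = range sign_cone.
Proof.
apply/seteqP; split=> [N [F [_ [w ->]] <-]|N [w _ <-]].
  by exists w => //; rewrite normal_cone_box.
exists (face_in_dir (box M) w); last exact: normal_cone_box.
split; last by exists w.
exists (box_vertex M (fun i => 0 < w 0 i)); apply/face_in_dir_boxP.
split=> i; rewrite mxE; first by case: ifP => _; rewrite lexx ltW.
by split=> [->//|/ltW]; rewrite leNgt => /negPf ->.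
Qed.

End Positive.
End Box.

(** * The cubic polytope as a box *)

Lemma card_ord_gt (m : nat) (i : 'I_m.+1) :
  #|[set j : 'I_m.+1 | i < j]%SET| = m - i.
Proof.
rewrite cardsE -sum1_card.
by rewrite -(big_geq_mkord i.+1 m.+1 xpredT (fun=> 1)) sum_nat_const_nat muln1.
Qed.

Lemma cubic_comp_le (m : nat) (T : permutree m.+1) (i : 'I_m.+1) :
  #|cubic_comp T i| <= m - i.
Proof.
rewrite -card_ord_gt; apply/subset_leq_card/fintype.subsetP => j.
by rewrite !inE => /andP[].
Qed.

Definition cubic_bounds (R : realType) (m : nat) : 'rV[R]_m :=
  (\row_(i < m) (m - i)%:R)%R.

Lemma cubic_polytope_box (R : realType) (m : nat)
    (delta : 'I_m.+1 -> decoration) :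
  cubic_polytope R delta = box (cubic_bounds R m).
Proof.
apply: conv_hull_box => [i|_ [T _ <-] i|S].
- by rewrite mxE ltr0n subn_gt0.
- by rewrite !mxE ler0n ler_nat; apply: cubic_comp_le.
(* [S] covers the first [m] indices; the value at the last is arbitrary, since the cubic vector has
   no coordinate there. *)
pose S' (i : 'I_m.+1) := if insub (val i) is Some k then S k else false.
exists (vertex_permutree delta S'); first exact: deco_vertex_permutree.
apply/rowP=> i; rewrite !mxE; set j := widen_ord _ i.
have jmax : j != ord_max by rewrite -(inj_eq val_inj) /= ltn_eqF.
rewrite cubic_comp_vertex_permutree // /S' valK.
by case: (S i); rewrite ?card_ord_gt ?cards0.
Qed.

Theorem theorem3p7 (R : realType) (n : nat) (hn : (0 < n)%N)
    (delta : 'I_n -> decoration) :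
  normally_equivalent (cubic_polytope R delta) (cube R n.-1).
Proof.
case: n hn delta => // m _ delta.
rewrite /normally_equivalent cubic_polytope_box cube_box !normal_fan_box //.
  by move=> i; rewrite mxE ltr0n subn_gt0.
by move=> i; rewrite mxE ltr01.
Qed.
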